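(* In the setting described in the context, let $\tau>0$, let $S:X\to\mathbb{R}^{n_s}$ be a linear edge-flow sensor map, and use its dual colocated actuator $C=S^*:\mathbb{R}^{n_s}\to X$ (Euclidean adjoint, with coordinate matrix $S^\top$). If $K:\mathbb{R}^{n_s}\to\mathbb{R}^{n_s}$ is linear with $K=K^*\preceq0$ and the actuator obeys $$\tau\dot u=S^*KS\bigl(f(\eta)-f_*\bigr),$$ then along trajectories of the closed system $$\dot V=-\omega^\top D\omega+\frac1\tau\bigl(S(f(\eta)-f_* )\bigr)^\top K\bigl(S(f(\eta)-f_* )\bigr)\le0 .$$ More specifically, let $\Sigma_\rho$ be a positive diagonal operator on $X$, let $H_{\Sigma_\rho}:\mathbb{R}^{b_1}\to X$ have $\Sigma_\rho^{-1}$-orthonormal columns spanning $\ker B$, assume $n_s=b_1$ and that $G:=SH_{\Sigma_\rho}$ is invertible, and choose, for $\kappa>0$, the gain $$K=-\kappa(GG^\top)^{-1}.$$ Then $$\dot V=-\omega^\top D\omega-\frac{\kappa}{\tau}\bigl\|G^{-1}S\bigl(f(\eta)-f_*\bigr)\bigr\|^2\le0 .$$ If (for this gain) the trajectory $(\eta,\omega)$ remains in a compact forward-invariant subset of the cohesive region $\mathcal{D}\times\mathbb{R}^n$, $\mathcal{D}=\{\eta\in X:|\eta_e|<\pi/2\text{ for all }e\in E\}$, then its line-flow output converges to the target: $f(\eta(t))\to f_*$ as $t\to\infty$.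
   Context: The graph (denoted here by its vertex set and edge set $E$) is finite and connected with $n$ vertices and $m=|E|$ edges, each with a fixed orientation; $X=\mathbb{R}^E$; the incidence matrix $B:X\to\mathbb{R}^n$ has, in the column of each oriented edge, entry $+1$ at the tail and $-1$ at the head; $b_1=m-n+1=\dim\ker B$. $M,D\in\mathbb{R}^{n\times n}$ are positive diagonal, $a_e>0$ for all $e\in E$, and $f(\eta)=\operatorname{diag}(a)\sin\eta$ (componentwise sine). The target is $\eta_*\in X$ with $f_*=f(\eta_* )$ and $p=Bf_*$. The full dynamics is $\dot\theta=\omega$, $M\dot\omega=p-D\omega-Bf(\eta)$ with $\eta=B^\top\theta+u$ and $u$ governed by the stated actuator law, where $\theta,\omega\in\mathbb{R}^n$, $u\in X$; in effective variables, $\dot\eta=B^\top\omega+\dot u$, $M\dot\omega+D\omega=p-Bf(\eta)$, so that $(\eta,\omega)$ satisfies a closed autonomous system. The storage is $$V(\eta,\omega)=\tfrac12\omega^\top M\omega+U(\eta)-U(\eta_* )-f_*^\top(\eta-\eta_* ),\qquad U(\eta)=\sum_{e\in E}a_e(1-\cos\eta_e),$$ and $\dot V$ is the derivative of $t\mapsto V(\eta(t),\omega(t))$ along a classical trajectory. $K\preceq0$ means $K$ is negative semidefinite. $\Sigma_\rho^{-1}$-orthonormal columns means $H_{\Sigma_\rho}^\top\Sigma_\rho^{-1}H_{\Sigma_\rho}=I_{b_1}$. *)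

(* Defs.v *)
From HB Require Import structures.
From mathcomp Require Import all_boot all_order all_algebra.
From mathcomp Require Import all_classical all_reals all_analysis.

Set Implicit Arguments.
Unset Strict Implicit.
Unset Printing Implicit Defensive.

Import Order.TTheory GRing.Theory Num.Theory.
Import numFieldNormedType.Exports.


Local Open Scope classical_set_scope.
Local Open Scope ring_scope.

(* Linear maps are matrices acting on column vectors, so that the Euclidean
    adjoint is the transpose. *)

(* The library norm on matrices is the sup norm, hence [dot] and [enorm]. *)
Definition dot (R : realType) k (x y : 'cV[R]_k) : R := (x^T *m y) 0 0.

Definition enorm (R : realType) k (x : 'cV[R]_k) : R := Num.sqrt (dot x x).

Definition negsemidef (R : realType) k (A : 'M[R]_k) : Prop :=
  forall x : 'cV[R]_k, dot x (A *m x) <= 0.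

Definition posdiag (R : realType) k (A : 'M[R]_k) : Prop :=
  is_diag_mx A /\ forall i, 0 < A i i.


Definition adjacent n m (tail head : 'I_m -> 'I_n) : rel 'I_n :=
  fun i j => [exists e, ((tail e == i) && (head e == j))
                     || ((tail e == j) && (head e == i))].

Definition graph_connected n m (tail head : 'I_m -> 'I_n) : Prop :=
  (0 < n)%N /\ forall i j, connect (adjacent tail head) i j.

(* Vertices are 'I_n and edges are 'I_m, so X is 'cV[R]_m. *)
Record network (R : realType) (n m : nat) := Network {
  tail : 'I_m -> 'I_n;
  head : 'I_m -> 'I_n;
  inertia : 'M[R]_n;
  damping : 'M[R]_n;
  weight : 'rV[R]_m;
  target : 'cV[R]_m;
  tail_neq_head : forall e, tail e != head e;
  network_connected : graph_connected tail head;
  inertia_posdiag : posdiag inertia;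
  damping_posdiag : posdiag damping;
  weight_gt0 : forall e, 0 < weight 0 e
}.

(* m - n + 1, written so that the truncated subtraction is exact: a connected
   graph has n <= m + 1. *)
Definition cycle_rank n m (R : realType) (N : network R n m) : nat :=
  (m.+1 - n)%N.

Definition incidence (R : realType) n m (N : network R n m) : 'M[R]_(n, m) :=
  \matrix_(i, e) ((tail N e == i)%:R - (head N e == i)%:R).

Definition flow (R : realType) n m (N : network R n m) (eta : 'cV[R]_m) :
    'cV[R]_m :=
  diag_mx (weight N) *m map_mx sin eta.

Definition target_flow (R : realType) n m (N : network R n m) : 'cV[R]_m :=
  flow N (target N).

Definition injection (R : realType) n m (N : network R n m) : 'cV[R]_n :=
  incidence N *m target_flow N.

Definition potential (R : realType) n m (N : network R n m)
    (eta : 'cV[R]_m) : R :=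
  \sum_(e < m) weight N 0 e * (1 - cos (eta e 0)).

Definition storage (R : realType) n m (N : network R n m)
    (eta : 'cV[R]_m) (omega : 'cV[R]_n) : R :=
  2^-1 * dot omega (inertia N *m omega)
  + potential N eta - potential N (target N)
  - dot (target_flow N) (eta - target N).

Definition cohesive (R : realType) (m : nat) : set 'cV[R]_m :=
  [set eta | forall e, `|eta e 0| < pi / 2].
Arguments cohesive : clear implicits.


Definition time_interval (R : realType) (J : set R) : Prop :=
  is_interval J /\ exists s t, [/\ J s, J t & s < t].

(* Derivative relative to J: the two-sided derivative at interior points of J,
   the one-sided one at an end point of J that belongs to J. *)
Definition has_deriv_on (R : realType) (V : normedModType R) (J : set R)
    (x : R -> V) (t : R) (v : V) : Prop :=
  (s - t)^-1 *: (x s - x t) @[s --> within J t^'] --> v.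

Definition eff_angle (R : realType) n m (N : network R n m)
    (theta : R -> 'cV[R]_n) (u : R -> 'cV[R]_m) (t : R) : 'cV[R]_m :=
  (incidence N)^T *m theta t + u t.

(* Here and below, A is the actuator gain: tau u' = A (f(eta) - f_* ). *)
Definition full_trajectory (R : realType) n m (N : network R n m) (tau : R)
    (A : 'M[R]_m) (J : set R)
    (theta omega : R -> 'cV[R]_n) (u : R -> 'cV[R]_m) : Prop :=
  forall t, J t ->
  let eta := eff_angle N theta u t in
  [/\ has_deriv_on J theta t (omega t),
      exists2 domega, has_deriv_on J omega t domega &
        inertia N *m domega =
        injection N - damping N *m omega t - incidence N *m flow N eta
    & exists2 du, has_deriv_on J u t du &
        tau *: du = A *m (flow N eta - target_flow N)].

Definition eff_trajectory (R : realType) n m (N : network R n m) (tau : R)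
    (A : 'M[R]_m) (J : set R)
    (eta : R -> 'cV[R]_m) (omega : R -> 'cV[R]_n) : Prop :=
  forall t, J t ->
  has_deriv_on J eta t
    ((incidence N)^T *m omega t
     + tau^-1 *: (A *m (flow N (eta t) - target_flow N)))
  /\ exists2 domega, has_deriv_on J omega t domega &
       inertia N *m domega + damping N *m omega t =
       injection N - incidence N *m flow N (eta t).

Definition forward_invariant (R : realType) n m (N : network R n m) (tau : R)
    (A : 'M[R]_m) (Q : set ('cV[R]_m * 'cV[R]_n)) : Prop :=
  forall eta omega, eff_trajectory N tau A `[0, +oo[ eta omega ->
  Q (eta 0, omega 0) -> forall t, 0 <= t -> Q (eta t, omega t).

(* Main.v *)
Require Import Defs.
From HB Require Import structures.
From mathcomp Require Import all_boot all_order all_algebra.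
From mathcomp Require Import all_classical all_reals all_analysis.
From mathcomp Require Import ring lra.

Set Implicit Arguments.
Unset Strict Implicit.
Unset Printing Implicit Defensive.

Import Order.TTheory GRing.Theory Num.Theory.
Import numFieldNormedType.Exports.

Local Open Scope classical_set_scope.
Local Open Scope ring_scope.

(** Along a trajectory the gradient of the storage is [(f(eta) - f_*, M omega)],
    and the terms [(f - f_* )^T B^T omega] coming from the angles and from the
    swing equation cancel because [p = B f_*].  What is left is the damping loss
    plus the actuator term [tau^-1 (f - f_* )^T S^T K S (f - f_* )], both of one
    sign ([energy_balance], [dissipation]).

    Convergence is proved with Barbalat's lemma ([barbalat]) instead of an
    invariance principle: if [x] has a limit at infinity and a Lipschitz
    derivative, then [x'] tends to 0.  Compactness bounds [eta] and [omega].
    The flow is bounded because the sine is, so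
    the equations of motion bound [eta'] and [omega'], and [eta], [omega],
    [f(eta)] and every polynomial in them are bounded and Lipschitz.  Then
    Barbalat's lemma applies twice.  The storage is monotone and bounded, hence
    converges, so its derivative tends to 0; with the gain
    [K = - kappa (G G^T)^-1] this forces [omega] and [z = G^-1 S (f - f_* )]
    to 0.  Now [omega] converges, so [omega'] tends to 0 and the swing equation
    gives [B (f - f_* ) -> 0].

    Finally [x |-> (B x, G^-1 S x)] is injective: if [B x = 0] then [x = H c],
    and [G^-1 S H c = c].  A left inverse ([sensor_left_inverse]) recovers
    [f - f_*] from two quantities that vanish at infinity ([flow_cvg]). *)

(** * Derivatives relative to a set of times *)

(** Reduces every limit of matrices below to limits of real functions. *)
Lemma mx_cvgP (R : realType) m n (T : Type) (F : set_system T) (FF : Filter F)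
    (f : T -> 'M[R]_(m, n)) (A : 'M[R]_(m, n)) :
  f s @[s --> F] --> A <-> forall i j, (f s i j : R^o) @[s --> F] --> (A i j : R^o).
Proof.
split=> [fA i j|fA].
  apply: (@cvg_comp _ _ _ f (fun M : 'M[R]_(m, n) => M i j : R^o) _ _ _ fA).
  exact: coord_continuous.
rewrite [A]matrix_sum_delta.
under eq_fun do rewrite [f _]matrix_sum_delta.
apply: cvg_big => [|i _]; first exact: add_continuous.
apply: cvg_big => [|j _]; first exact: add_continuous.
exact: cvgZr_tmp.
Qed.

Section RelativeDerivative.
Variables (R : realType) (J : set R) (t : R).

Lemma has_deriv_on_cvg (V : normedModType R) (x : R -> V) v :
  has_deriv_on J x t v -> x s @[s --> within J t^'] --> x t.
Proof.
move=> xv.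
have st : (s - t : R^o) @[s --> within J t^'] --> (0 : R^o).
  have sub : within J t^' `=>` nbhs t.
    exact: cvg_trans (cvg_within J) (cvg_within _).
  by rewrite -(subrr t); apply: cvgB; [exact: sub|exact: cvg_cst].
(* holds at [s = t] too, since both sides are then [x t] *)
have xE s : x s = (s - t) *: ((s - t)^-1 *: (x s - x t)) + x t.
  have [->|st0] := eqVneq s t; first by rewrite subrr scale0r add0r.
  by rewrite scalerA divff ?subr_eq0// scale1r subrK.
under eq_fun do rewrite xE.
suff : ((s - t) *: ((s - t)^-1 *: (x s - x t)) + x t) @[s --> within J t^']
    --> 0 *: v + x t by rewrite scale0r add0r.
by apply: cvgD; [exact: cvgZ|exact: cvg_cst].
Qed.

Lemma has_deriv_onP m n (x : R -> 'M[R]_(m, n)) v :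
  has_deriv_on J x t v <->
  forall i j, has_deriv_on J (fun s => x s i j : R^o) t (v i j).
Proof.
have E i j : (fun s => ((s - t)^-1 *: (x s - x t)) i j : R^o) =
    (fun s => (s - t)^-1 *: (x s i j - x t i j : R^o)).
  by apply/funext => s; rewrite !mxE.
rewrite /has_deriv_on mx_cvgP; split=> xv i j; have := xv i j.
  by rewrite E.
by rewrite -E.
Qed.

Lemma has_deriv_on_cst (V : normedModType R) (c : V) :
  has_deriv_on J (fun=> c) t 0.
Proof.
rewrite /has_deriv_on; under eq_fun do rewrite subrr scaler0.
exact: cvg_cst.
Qed.

Lemma has_deriv_onD (V : normedModType R) (x y : R -> V) v w :
  has_deriv_on J x t v -> has_deriv_on J y t w ->
  has_deriv_on J (fun s => x s + y s) t (v + w).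
Proof.
move=> xv yw; rewrite /has_deriv_on.
by under eq_fun do rewrite opprD addrACA scalerDr; exact: cvgD.
Qed.

Lemma has_deriv_on_sum (V : normedModType R) I (r : seq I) (x : I -> R -> V) v :
  (forall i, has_deriv_on J (x i) t (v i)) ->
  has_deriv_on J (fun s => \sum_(i <- r) x i s) t (\sum_(i <- r) v i).
Proof.
move=> xv; elim: r => [|i r IHr].
  rewrite big_nil; under eq_fun do rewrite big_nil.
  exact: has_deriv_on_cst.
rewrite big_cons; under eq_fun do rewrite big_cons.
exact: has_deriv_onD.
Qed.

Lemma has_deriv_onM (x y : R -> R) (v w : R) :
  has_deriv_on J (x : R -> R^o) t v -> has_deriv_on J (y : R -> R^o) t w ->
  has_deriv_on J ((fun s => x s * y s) : R -> R^o) t (v * y t + x t * w).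
Proof.
move=> xv yw; rewrite /has_deriv_on.
have E s : (s - t)^-1 *: (x s * y s - x t * y t : R^o) =
    ((s - t)^-1 *: (x s - x t : R^o)) * y s +
    x t * ((s - t)^-1 *: (y s - y t : R^o)).
  by rewrite /GRing.scale /=; ring.
under eq_fun do rewrite E.
apply: cvgD; last exact: cvgMl_tmp.
apply: cvgM => //.
exact: (has_deriv_on_cvg yw).
Qed.

(** Both difference quotients are related by Caratheodory's slope function of
    [g], which avoids dividing by [x s - x t]. *)
Lemma has_deriv_on_comp (g x : R -> R) (dg v : R) :
  has_deriv_on J (x : R -> R^o) t v -> is_derive (x t) 1 g dg ->
  has_deriv_on J ((fun s => g (x s)) : R -> R^o) t (dg * v).
Proof.
move=> xv /is_derive1_caratheodory[h [gE hc <-]]; rewrite /has_deriv_on.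
have E s : (s - t)^-1 *: (g (x s) - g (x t) : R^o) =
    h (x s) * ((s - t)^-1 *: (x s - x t : R^o)).
  by rewrite gE /GRing.scale /=; ring.
under eq_fun do rewrite E.
apply: cvgM => //.
exact: (@cvg_comp _ _ _ x h _ _ _ (has_deriv_on_cvg xv) hc).
Qed.

Lemma has_deriv_on_mulmx m n p (A : 'M[R]_(m, n)) (x : R -> 'M[R]_(n, p)) v :
  has_deriv_on J x t v -> has_deriv_on J (fun s => A *m x s) t (A *m v).
Proof.
move=> /has_deriv_onP xv; apply/has_deriv_onP => i j; rewrite mxE.
under eq_fun do rewrite mxE.
apply: has_deriv_on_sum => k.
have := has_deriv_onM (has_deriv_on_cst (A i k : R^o)) (xv k j).
by rewrite mul0r add0r.
Qed.

Lemma has_deriv_on_dot k (x y : R -> 'cV[R]_k) v w :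
  has_deriv_on J x t v -> has_deriv_on J y t w ->
  has_deriv_on J ((fun s => dot (x s) (y s)) : R -> R^o) t
    (dot v (y t) + dot (x t) w).
Proof.
move=> /has_deriv_onP xv /has_deriv_onP yw; rewrite /dot !mxE -big_split /=.
under eq_fun do rewrite mxE.
apply: has_deriv_on_sum => i; rewrite !mxE.
under eq_fun do rewrite mxE.
exact: has_deriv_onM.
Qed.

(** Passes from the relative derivative to the ordinary one, for which the mean
    value theorem is available. *)
Lemma has_deriv_on_is_derive (x : R -> R) (v : R) :
  nbhs t J -> has_deriv_on J (x : R -> R^o) t v -> is_derive t 1 x v.
Proof.
move=> Jt xv; apply/is_derive1_caratheodory.
exists (fun s => if s == t then v else (s - t)^-1 * (x s - x t)); split.
- move=> s; case: eqVneq => [->|st]; first by rewrite !subrr mulr0.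
  by rewrite mulrAC mulVf ?mul1r// subr_eq0.
- apply/continuous_withinNx; rewrite eqxx.
  suff JE : within J t^' = t^'.
    rewrite /has_deriv_on JE in xv; apply: cvg_trans xv; apply: near_eq_cvg.
    near=> s; have /negPf -> // : s != t by near: s; exact: nbhs_dnbhs_neq.
  rewrite /dnbhs; apply/seteqP; split=> P; rewrite /within/= => h.
    by apply: filterS2 Jt h => s Js /[apply]; exact.
  by apply: filterS h => s /[apply].
- by rewrite eqxx.
Unshelve. all: by end_near.
Qed.

End RelativeDerivative.

(** * The Euclidean product *)

Section Dot.
Variable R : realType.

Lemma dotE k (x y : 'cV[R]_k) : dot x y = \sum_i x i 0 * y i 0.
Proof. by rewrite /dot mxE; apply: eq_bigr => i _; rewrite mxE. Qed.

Lemma dotC k (x y : 'cV[R]_k) : dot x y = dot y x.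
Proof. by rewrite !dotE; apply: eq_bigr => i _; rewrite mulrC. Qed.

Lemma dotDr k (x y z : 'cV[R]_k) : dot x (y + z) = dot x y + dot x z.
Proof. by rewrite /dot mulmxDr mxE. Qed.

Lemma dotNr k (x y : 'cV[R]_k) : dot x (- y) = - dot x y.
Proof. by rewrite /dot mulmxN mxE. Qed.

Lemma dot0l k (x : 'cV[R]_k) : dot 0 x = 0.
Proof. by rewrite /dot trmx0 mul0mx mxE. Qed.

Lemma dotZr k (a : R) (x y : 'cV[R]_k) : dot x (a *: y) = a * dot x y.
Proof. by rewrite /dot -scalemxAr mxE. Qed.

Lemma dot_mulmxr k l (A : 'M[R]_(k, l)) (x : 'cV[R]_k) (y : 'cV[R]_l) :
  dot x (A *m y) = dot (A^T *m x) y.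
Proof. by rewrite /dot trmx_mul trmxK mulmxA. Qed.

Lemma dot_ge0 k (x : 'cV[R]_k) : 0 <= dot x x.
Proof. by rewrite dotE sumr_ge0// => i _; rewrite -expr2 sqr_ge0. Qed.

Lemma sqr_le_dot k (x : 'cV[R]_k) i : x i 0 ^+ 2 <= dot x x.
Proof.
rewrite dotE (bigD1 i)//= -expr2 lerDl sumr_ge0// => j _.
by rewrite -expr2 sqr_ge0.
Qed.

Lemma enormK k (x : 'cV[R]_k) : enorm x ^+ 2 = dot x x.
Proof. by rewrite sqr_sqrtr// dot_ge0. Qed.

Section PosDiag.
Variables (k : nat) (A : 'M[R]_k).
Hypothesis A_posdiag : posdiag A.

Lemma posdiag_trmx : A^T = A.
Proof.
apply/matrixP => i j; rewrite mxE; have [->//|ij] := eqVneq i j.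
by case: A_posdiag => /is_diag_mxP Ad _; rewrite !Ad// eq_sym.
Qed.

Lemma posdiag_mulmx (x : 'cV[R]_k) i : (A *m x) i 0 = A i i * x i 0.
Proof.
rewrite mxE (bigD1 i)//= big1 ?addr0// => j ji.
by case: A_posdiag => /is_diag_mxP -> //; rewrite ?mul0r// eq_sym.
Qed.

Lemma dot_posdiag (x : 'cV[R]_k) :
  dot x (A *m x) = \sum_i A i i * x i 0 ^+ 2.
Proof.
by rewrite dotE; apply: eq_bigr => i _; rewrite posdiag_mulmx mulrCA -expr2.
Qed.

Lemma dot_posdiag_ge0 (x : 'cV[R]_k) : 0 <= dot x (A *m x).
Proof.
rewrite dot_posdiag sumr_ge0// => i _.
by rewrite mulr_ge0 ?sqr_ge0 ?ltW//; case: A_posdiag.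
Qed.

Lemma sqr_le_dot_posdiag (x : 'cV[R]_k) i :
  A i i * x i 0 ^+ 2 <= dot x (A *m x).
Proof.
rewrite dot_posdiag (bigD1 i)//= lerDl sumr_ge0// => j _.
by rewrite mulr_ge0 ?sqr_ge0 ?ltW//; case: A_posdiag.
Qed.

End PosDiag.

(** [(G G^T)^-1 = G^-T G^-1], so the quadratic form of the gain is a square. *)
Lemma gramK k (G : 'M[R]_k) (y : 'cV[R]_k) : G \in unitmx ->
  dot y (invmx (G *m G^T) *m y) = enorm (invmx G *m y) ^+ 2.
Proof.
move=> Gu; have -> : invmx (G *m G^T) = (invmx G)^T *m invmx G.
  have GGu : G *m G^T \in unitmx by rewrite unitmx_mul Gu unitmx_tr.
  apply: (can_inj (mulKmx GGu)); rewrite mulmxV// -mulmxA (mulmxA G^T).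
  by rewrite -trmx_mul mulVmx// trmx1 mul1mx mulmxV.
by rewrite -mulmxA dot_mulmxr trmxK enormK.
Qed.

End Dot.

(** * Energy balance *)

Section EnergyBalance.
Variables (R : realType) (n m : nat) (N : network R n m).

Lemma flowE eta e : flow N eta e 0 = weight N 0 e * sin (eta e 0).
Proof. by rewrite /flow mul_diag_mx !mxE. Qed.

Lemma has_deriv_on_potential J (eta : R -> 'cV[R]_m) t deta :
  has_deriv_on J eta t deta ->
  has_deriv_on J ((fun s => potential N (eta s)) : R -> R^o) t
    (dot (flow N (eta t)) deta).
Proof.
move=> /has_deriv_onP etad; rewrite dotE.
apply: has_deriv_on_sum => e; rewrite flowE -mulrA.
have H : has_deriv_on J ((fun s => 1 - cos (eta s e 0)) : R -> R^o) t
    (sin (eta t e 0) * deta e 0).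
  apply: (@has_deriv_on_comp _ _ _ (fun y => 1 - cos y)) (etad e 0) _.
  by apply: is_derive_eq; ring.
have := has_deriv_onM (has_deriv_on_cst J t (weight N 0 e : R^o)) H.
by rewrite mul0r add0r.
Qed.

Lemma has_deriv_on_eff_angle J theta u t omega du :
  has_deriv_on J theta t omega -> has_deriv_on J u t du ->
  has_deriv_on J (eff_angle N theta u) t ((incidence N)^T *m omega + du).
Proof. by move=> th uu; apply: has_deriv_onD => //; exact: has_deriv_on_mulmx. Qed.

Lemma has_deriv_on_storage J (eta : R -> 'cV[R]_m) omega t deta domega :
  has_deriv_on J eta t deta -> has_deriv_on J omega t domega ->
  has_deriv_on J ((fun s => storage N (eta s) (omega s)) : R -> R^o) t
    (dot (omega t) (inertia N *m domega)
     + dot (flow N (eta t) - target_flow N) deta).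
Proof.
move=> etad omegad.
have kin := has_deriv_onM (has_deriv_on_cst J t (2^-1 : R^o))
  (has_deriv_on_dot omegad (has_deriv_on_mulmx (A := inertia N) omegad)).
have lin := has_deriv_on_dot (has_deriv_on_cst J t (- target_flow N))
  (has_deriv_onD etad (has_deriv_on_cst J t (- target N))).
have cst := has_deriv_on_cst J t (- potential N (target N) : R^o).
have := has_deriv_onD (has_deriv_onD (has_deriv_onD kin
  (has_deriv_on_potential etad)) cst) lin.
rewrite /storage; set v := (X in has_deriv_on _ _ _ X -> _).
set F := (X in has_deriv_on _ X _ v -> _).
have -> : F = (fun s => 2^-1 * dot (omega s) (inertia N *m omega s) +
    potential N (eta s) - potential N (target N) -
    dot (target_flow N) (eta s - target N)).
  by apply/funext => s; rewrite /F [dot (- _) _]dotC dotNr [dot _ (target_flow N)]dotC.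
congr has_deriv_on; rewrite /v.
have -> : dot domega (inertia N *m omega t) = dot (omega t) (inertia N *m domega).
  by rewrite dot_mulmxr (posdiag_trmx (inertia_posdiag N)) dotC.
rewrite dot0l addr0 [dot (- _) _]dotC [dot (_ - _) _]dotC !(dotDr, dotNr).
by rewrite [dot (flow _ _) deta]dotC mul0r !addr0; field.
Qed.

(** The work [dot (f - f_* ) (B^T omega)] done on the angles is the opposite of
    the work of the net injection [p - B f = - B (f - f_* )] on the velocities,
    hence only damping and actuation remain. *)
Lemma energy_balance tau A J theta omega u t : 0 < tau ->
  full_trajectory N tau A J theta omega u -> J t ->
  let eta := eff_angle N theta u in
  let x := flow N (eta t) - target_flow N in
  has_deriv_on J ((fun s => storage N (eta s) (omega s)) : R -> R^o) t
    (- dot (omega t) (damping N *m omega t) + tau^-1 * dot x (A *m x)).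
Proof.
move=> tau0 traj Jt eta x.
have [thetad [domega omegad swing] [du ud act]] := traj t Jt.
have := has_deriv_on_storage (has_deriv_on_eff_angle thetad ud) omegad.
congr has_deriv_on; rewrite swing -/eta -/x.
have -> : du = tau^-1 *: (A *m x) by rewrite -act scalerA mulVf ?scale1r ?gt_eqF.
rewrite [dot x _]dotDr dotZr addrA; congr (_ + _).
rewrite dot_mulmxr trmxK [dot _ (omega t)]dotC /x mulmxBr -/(injection N).
by rewrite -/eta !(dotDr, dotNr); ring.
Qed.

End EnergyBalance.

(** * Bounded Lipschitz functions and Barbalat's lemma *)

Section Asymptotics.
Variable R : realType.
Implicit Types x y g dx : R -> R.

(** Positive times only: at time 0 a trajectory has just a one-sided derivative. *)
Definition bounded_pos x := exists C, forall t, 0 < t -> `|x t| <= C.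

Definition lipschitz_pos x :=
  exists C, forall s t, 0 < s -> 0 < t -> `|x s - x t| <= C * `|s - t|.

(** Boundedness makes this class of Lipschitz functions stable under products. *)
Definition tame x := bounded_pos x /\ lipschitz_pos x.

Lemma bounded_posD x y :
  bounded_pos x -> bounded_pos y -> bounded_pos (fun t => x t + y t).
Proof.
move=> [C xC] [D yD]; exists (C + D) => t t0.
by rewrite (le_trans (ler_normD _ _))// lerD ?xC ?yD.
Qed.

Lemma bounded_posM x y :
  bounded_pos x -> bounded_pos y -> bounded_pos (fun t => x t * y t).
Proof.
move=> [C xC] [D yD]; exists (C * D) => t t0.
by rewrite normrM ler_pM ?xC ?yD.
Qed.

Lemma bounded_pos_cst (c : R) : bounded_pos (fun=> c).
Proof. by exists `|c|. Qed.

Lemma tameD x y : tame x -> tame y -> tame (fun t => x t + y t).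
Proof.
move=> [xb [C xC]] [yb [D yD]]; split; first exact: bounded_posD.
exists (C + D) => s t s0 t0; rewrite opprD addrACA mulrDl.
by rewrite (le_trans (ler_normD _ _))// lerD ?xC ?yD.
Qed.

Lemma tameM x y : tame x -> tame y -> tame (fun t => x t * y t).
Proof.
move=> [xb [C xC]] [yb [D yD]]; split; first exact: bounded_posM.
have [[X xX] [Y yY]] := (xb, yb).
exists (X * D + Y * C) => s t s0 t0.
have -> : x s * y s - x t * y t = x s * (y s - y t) + y t * (x s - x t).
  by ring.
rewrite (le_trans (ler_normD _ _))// !normrM mulrDl -!mulrA.
by rewrite lerD// ler_pM ?xX ?yY ?xC ?yD.
Qed.

Lemma tame_cst (c : R) : tame (fun=> c).
Proof.
split; first exact: bounded_pos_cst.
by exists 0 => s t _ _; rewrite subrr normr0 mul0r.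
Qed.

(** Both [bounded_pos] and [tame] are algebras of functions containing the
    constants; the matrix operations are treated once for any such class. *)
Section Subalgebra.
Variable P : (R -> R) -> Prop.
Hypothesis P_cst : forall c, P (fun=> c).
Hypothesis P_D : forall x y, P x -> P y -> P (fun t => x t + y t).
Hypothesis P_M : forall x y, P x -> P y -> P (fun t => x t * y t).

Lemma closed_sum I (r : seq I) (x : I -> R -> R) :
  (forall i, P (x i)) -> P (fun t => \sum_(i <- r) x i t).
Proof.
move=> Px; elim: r => [|i r IHr].
  by under eq_fun do rewrite big_nil.
by under eq_fun do rewrite big_cons; exact: P_D.
Qed.

Lemma closed_mulmx m n p (A : 'M[R]_(m, n)) (x : R -> 'M[R]_(n, p)) :
  (forall i j, P (fun t => x t i j)) -> forall i j, P (fun t => (A *m x t) i j).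
Proof.
move=> Px i j; under eq_fun do rewrite mxE.
by apply: closed_sum => k; exact: P_M.
Qed.

Lemma closed_addmx m n (x y : R -> 'M[R]_(m, n)) :
  (forall i j, P (fun t => x t i j)) -> (forall i j, P (fun t => y t i j)) ->
  forall i j, P (fun t => (x t + y t) i j).
Proof.
by move=> Px Py i j; under eq_fun do rewrite mxE; exact: P_D.
Qed.

Lemma closed_dot k (x y : R -> 'cV[R]_k) :
  (forall i j, P (fun t => x t i j)) -> (forall i j, P (fun t => y t i j)) ->
  P (fun t => dot (x t) (y t)).
Proof.
move=> Px Py; under eq_fun do rewrite dotE.
by apply: closed_sum => i; exact: P_M.
Qed.

End Subalgebra.

Lemma mvt_pos x dx (a b : R) : (forall t : R, 0 < t -> is_derive t 1 x (dx t)) ->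
  0 < a -> a < b -> exists2 c, a < c < b & x b - x a = dx c * (b - a).
Proof.
move=> xd a0 ab.
have [||c cab ->] := MVT (f := x) (df := dx) ab.
- by move=> t; rewrite in_itv => /andP[ta _]; apply: xd; exact: lt_trans ta.
- apply: derivable_within_continuous => t; rewrite in_itv => /andP[ta _].
  by apply: ex_derive; apply: xd; exact: lt_le_trans ta.
- by exists c.
Qed.

Lemma derive_bounded_lipschitz x dx :
  (forall t : R, 0 < t -> is_derive t 1 x (dx t)) -> bounded_pos dx ->
  lipschitz_pos x.
Proof.
move=> xd [C dxC]; exists C => s t.
wlog st : s t / s < t => [H|] s0 t0.
  have [st|ts|->] := ltgtP s t; first exact: H.
    by rewrite distrC [`|s - t|]distrC H.
  by rewrite !subrr normr0 mulr0.
rewrite distrC [`|s - t|]distrC.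
have [c /andP[sc _] ->] := mvt_pos xd s0 st.
by rewrite normrM ler_wpM2r// dxC// (lt_trans s0).
Qed.

Lemma lipschitz_sin (a b : R) : `|sin a - sin b| <= `|a - b|.
Proof.
wlog ab : a b / a < b => [H|].
  have [ab|ba|->] := ltgtP a b; first exact: H.
    by rewrite distrC [leRHS]distrC H.
  by rewrite !subrr normr0.
rewrite distrC [leRHS]distrC.
have [|c _ ->] := MVT (f := sin) (df := cos) ab.
- by apply: continuous_subspaceT; exact: continuous_sin.
- rewrite normrM ler_piMl// ler_norml cos_le1 andbT; exact: cos_geN1.
Qed.

Lemma tame_sin x : lipschitz_pos x -> tame (fun t => sin (x t)).
Proof.
move=> [C xC]; split.
  by exists 1 => t _; rewrite ler_norml sin_le1 sin_geN1.
by exists C => s t s0 t0; rewrite (le_trans (lipschitz_sin _ _))// xC.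
Qed.

(** The limit is the infimum of the values at positive times. *)
Lemma nonincreasing_bounded_cvg x :
  (forall s t, 0 < s -> s < t -> x t <= x s) -> bounded_pos x ->
  exists l : R, x t @[t --> +oo] --> l.
Proof.
move=> xdec [C xC].
pose E := [set x t | t in [set t | 0 < t]].
have Ei : has_inf E.
  split; first by exists (x 1), 1 => //=.
  by exists (- C) => _ [t /= t0 <-]; have := xC _ t0; rewrite ler_norml => /andP[].
exists (inf E); apply/cvgrPdist_le => e e0.
have [_ [T /= T0 <-] xT] := inf_adherent e0 Ei.
near=> t.
have Tt : T < t by near: t; apply: nbhs_pinfty_gt; exact: num_real.
have xTt := xdec _ _ T0 Tt.
have : inf E <= x t by apply: ge_inf; [exact: Ei.2|exists t => //=; exact: lt_trans Tt].
by rewrite ler_norml; lra.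
Unshelve. all: by end_near.
Qed.

(** By the mean value theorem, [x (t + d) - x t] is [d] times a value of [dx] at
    distance at most [d] from [t].  The increment is small for large [t], and
    [dx] varies by at most [C d] on that interval. *)
Lemma barbalat x dx l : (forall t : R, 0 < t -> is_derive t 1 x (dx t)) ->
  lipschitz_pos dx -> x t @[t --> +oo] --> (l : R) ->
  dx t @[t --> +oo] --> (0 : R).
Proof.
move=> xd [C dxC] xl; apply/cvgrPdist_le => e e0.
(* Half of [e] pays for the variation of [dx] over a step of length [d]; the
   other half for the increment of [x], two values within [d * e / 4] of [l]. *)
pose d := e / (2 * (`|C| + 1)).
have C1 : 0 < `|C| + 1 by rewrite ltr_wpDl.
have d0 : 0 < d by rewrite divr_gt0// mulr_gt0.
have Cd : `|C| * d <= e / 2.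
  have : d * (`|C| + 1) = e / 2 by rewrite /d; field; lra.
  lra.
have /cvgrPdist_le/(_ (d * e / 4)) xd4 := xl.
have /xd4[T [_ xT]] : 0 < d * e / 4 by rewrite divr_gt0 ?mulr_gt0.
near=> t.
have t0 : 0 < t by near: t; apply: nbhs_pinfty_gt; exact: num_real.
have tT : T < t by near: t; apply: nbhs_pinfty_gt; exact: num_real.
have td : t < t + d by rewrite ltrDl.
have [c /andP[tc cd] xE] := mvt_pos xd t0 td.
have := xT t tT; have := xT (t + d) (lt_trans tT td) => /=.
rewrite !ler_norml => /andP[x1 x2] /andP[x3 x4].
have dxc : `|dx c| <= e / 2.
  rewrite -(ler_pM2r d0) -{1}[d]gtr0_norm// -normrM.
  have -> : dx c * d = x (t + d) - x t by rewrite xE; ring.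
  by rewrite ler_norml; lra.
have c0 : 0 < c := lt_trans t0 tc.
have := dxC t c t0 c0; have : `|t - c| <= d by rewrite ler_norml; lra.
move=> tcd dxtc; have : `|dx t - dx c| <= e / 2.
  rewrite (le_trans dxtc)// (le_trans _ Cd)//.
  exact: le_trans (ler_wpM2r _ (ler_norm C)) (ler_wpM2l _ tcd).
by move: dxc; rewrite !ler_norml; lra.
Unshelve. all: by end_near.
Qed.

Lemma cvg0_sqr_le (c : R) x g : 0 < c -> (forall t, 0 < t -> c * x t ^+ 2 <= g t) ->
  g t @[t --> +oo] --> (0 : R) -> x t @[t --> +oo] --> (0 : R).
Proof.
move=> c0 xg g0; apply/cvgrPdist_le => e e0.
have /cvgrPdist_le/(_ (c * e ^+ 2)) gd := g0.
near=> t.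
have t0 : 0 < t by near: t; apply: nbhs_pinfty_gt; exact: num_real.
have : `|0 - g t| <= c * e ^+ 2.
  by near: t; apply: gd; rewrite mulr_gt0 ?exprn_gt0.
rewrite !sub0r !normrN => /(le_trans (ler_norm _))/(le_trans (xg t t0)).
by rewrite ler_pM2l// -real_normK ?num_real// ler_pXn2r// nnegrE ltW.
Unshelve. all: by end_near.
Qed.

End Asymptotics.

(** * Dissipation *)

Section Gain.
Variables (R : realType) (k : nat) (G : 'M[R]_k) (kappa : R).
Hypotheses (G_unit : G \in unitmx) (kappa_gt0 : 0 < kappa).

Let K : 'M[R]_k := - (kappa *: invmx (G *m G^T)).

Lemma dot_gain (y : 'cV[R]_k) :
  dot y (K *m y) = - (kappa * enorm (invmx G *m y) ^+ 2).
Proof. by rewrite mulNmx dotNr -scalemxAl dotZr gramK. Qed.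

Lemma gain_negsemidef : negsemidef K.
Proof.
by move=> y; rewrite dot_gain oppr_le0 mulr_ge0 ?sqr_ge0// ltW.
Qed.

End Gain.

Section Dissipation.
Variables (R : realType) (n m ns : nat) (N : network R n m).
Variables (tau : R) (S : 'M[R]_(ns, m)) (K : 'M[R]_ns).
Hypotheses (tau_gt0 : 0 < tau) (K_neg : negsemidef K).

Lemma dissipation J theta omega u t :
  full_trajectory N tau (S^T *m K *m S) J theta omega u -> J t ->
  let eta := eff_angle N theta u in
  let y := S *m (flow N (eta t) - target_flow N) in
  let dV := - dot (omega t) (damping N *m omega t) + tau^-1 * dot y (K *m y) in
  has_deriv_on J (fun s => storage N (eta s) (omega s) : R^o) t dV /\ dV <= 0.
Proof.
move=> traj Jt eta y dV; split.
  have := energy_balance tau_gt0 traj Jt; rewrite -/eta.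
  congr has_deriv_on; congr (_ + _ * _).
  by rewrite -!mulmxA dot_mulmxr trmxK.
rewrite /dV -oppr_ge0 opprD opprK addr_ge0 ?dot_posdiag_ge0//.
  exact: damping_posdiag.
by rewrite -mulrN mulr_ge0 ?invr_ge0 ?oppr_ge0 ?K_neg// ltW.
Qed.

End Dissipation.

(** * Recovering the flow from injections and sensor *)

Lemma posdiag_unitmx (R : realType) k (A : 'M[R]_k) : posdiag A -> A \in unitmx.
Proof.
move=> [/diag_mxP[d ->] d_gt0].
rewrite unitmxE det_diag unitfE; apply/prodf_neq0 => i _.
by have := d_gt0 i; rewrite !mxE eqxx mulr1n => /gt_eqF ->.
Qed.

(** The sensor sees exactly what the incidence matrix misses: a vector killed by
    both blocks is [H z] with [(S H)^-1 S H z = z = 0]. *)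
Lemma sensor_left_inverse (F : fieldType) n m k (B : 'M[F]_(n, m))
    (S : 'M[F]_(k, m)) (H : 'M[F]_(m, k)) :
  (forall x : 'cV[F]_m, B *m x = 0 -> exists z, x = H *m z) ->
  S *m H \in unitmx ->
  exists L : 'M[F]_(m, n + k),
    L *m col_mx B (invmx (S *m H) *m S) = 1%:M.
Proof.
move=> kerB SH; apply/row_fullP.
rewrite /row_full -mxrank_tr -/(row_free _) -kermx_eq0.
apply/rowV0P => v /sub_kermxP /(congr1 trmx).
rewrite trmx_mul trmxK trmx0 mul_col_mx => /eqP; rewrite col_mx_eq0.
move=> /andP[/eqP /kerB[z vE] /eqP]; rewrite vE -mulmxA (mulmxA S) mulKmx// => z0.
by apply: trmx_inj; rewrite vE z0 mulmx0 trmx0.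
Qed.

Lemma le_mx_norm (R : realType) m n (A : 'M[R]_(m, n)) i j : `|A i j| <= `|A|.
Proof.
by rewrite [leRHS]/Num.norm /= mx_normrE; apply/bigmax_geP; right; exists (i, j).
Qed.

Lemma has_deriv_on_pos (R : realType) (x : R -> R) (t v : R) : 0 < t ->
  has_deriv_on `[0, +oo[ (x : R -> R^o) t v -> is_derive t 1 x v.
Proof.
move=> t0; apply: has_deriv_on_is_derive.
near=> s; rewrite /= in_itv /= andbT.
by near: s; exact: lt_le_nbhsr.
Unshelve. all: by end_near.
Qed.

Lemma cvg_mulmx (R : realType) m n p (T : Type) (F : set_system T)
    (FF : Filter F) (A : 'M[R]_(m, n)) (f : T -> 'M[R]_(n, p)) B :
  f s @[s --> F] --> B -> A *m f s @[s --> F] --> A *m B.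
Proof.
move=> /mx_cvgP fB; apply/mx_cvgP => i j; rewrite mxE.
under eq_fun do rewrite mxE.
apply: cvg_big => [|k _]; first exact: add_continuous.
exact: cvgMl_tmp.
Qed.

(** * Convergence of the flow *)

Section Convergence.
Variables (R : realType) (n m ns : nat) (N : network R n m).
Variables (tau kappa : R) (S : 'M[R]_(ns, m)) (H : 'M[R]_(m, ns)).
Hypotheses (tau_gt0 : 0 < tau) (kappa_gt0 : 0 < kappa).
Hypothesis ker_incidence :
  forall x : 'cV[R]_m, incidence N *m x = 0 -> exists z, x = H *m z.
Hypothesis SH_unit : S *m H \in unitmx.

Let G := S *m H.
Let K : 'M[R]_ns := - (kappa *: invmx (G *m G^T)).

Variables (theta omega : R -> 'cV[R]_n) (u : R -> 'cV[R]_m).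
Hypothesis traj : full_trajectory N tau (S^T *m K *m S) `[0, +oo[ theta omega u.
Let eta := eff_angle N theta u.

Hypothesis eta_bounded : forall i j, bounded_pos (fun t => eta t i j).
Hypothesis omega_bounded : forall i j, bounded_pos (fun t => omega t i j).

Let x t := flow N (eta t) - target_flow N.
Let domega t := invmx (inertia N) *m
  (injection N + ((- damping N) *m omega t + (- incidence N) *m flow N (eta t))).
Let deta t :=
  (incidence N)^T *m omega t + (tau^-1 *: (S^T *m K *m S)) *m x t.
Let z t := invmx G *m S *m x t.

Let bounded_mulmx := closed_mulmx (@bounded_pos_cst R) (@bounded_posD R) (@bounded_posM R).
Let bounded_addmx := closed_addmx (@bounded_posD R).
Let bounded_dot := closed_dot (@bounded_pos_cst R) (@bounded_posD R) (@bounded_posM R).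
Let tame_mulmx := closed_mulmx (@tame_cst R) (@tameD R) (@tameM R).
Let tame_addmx := closed_addmx (@tameD R).
Let tame_dot := closed_dot (@tame_cst R) (@tameD R) (@tameM R).

Let has_deriv_omega i (t : R) : 0 < t -> is_derive t 1 (fun s => omega s i 0) (domega t i 0).
Proof.
move=> t0; apply: has_deriv_on_pos => //.
have [|_ [w wd wE] _] := traj (t := t); first by rewrite /= in_itv /= andbT ltW.
have -> : domega t = w.
  have Mu := posdiag_unitmx (inertia_posdiag N).
  by apply: (can_inj (mulKmx Mu)); rewrite wE mulKVmx// !mulNmx addrA.
exact: (has_deriv_onP _ _ _ _).1.
Qed.

Let has_deriv_eta e (t : R) : 0 < t -> is_derive t 1 (fun s => eta s e 0) (deta t e 0).
Proof.
move=> t0; apply: has_deriv_on_pos => //.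
have [|th _ [w wd wE]] := traj (t := t); first by rewrite /= in_itv /= andbT ltW.
have -> : deta t = (incidence N)^T *m omega t + w.
  by rewrite /deta -scalemxAl -wE scalerA mulVf ?scale1r ?gt_eqF.
by apply: (has_deriv_onP _ _ _ _).1; exact: has_deriv_on_eff_angle.
Qed.

(* The sine bounds the flow whatever [eta] is, so that the right-hand sides of
   the equations of motion are bounded as soon as [omega] is. *)
Let flow_bounded i j : bounded_pos (fun t => flow N (eta t) i j).
Proof.
apply: bounded_mulmx => e k; exists 1 => t _.
by rewrite mxE ler_norml sin_le1 sin_geN1.
Qed.

Let x_bounded i j : bounded_pos (fun t => x t i j).
Proof. by apply: bounded_addmx => // *; exact: bounded_pos_cst. Qed.

Let eta_lipschitz e : lipschitz_pos (fun t => eta t e 0).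
Proof.
apply: derive_bounded_lipschitz (fun t => @has_deriv_eta e t) _.
by apply: bounded_addmx => i j; exact: bounded_mulmx.
Qed.

Let omega_tame i j : tame (fun t => omega t i j).
Proof.
rewrite ord1; split => //.
apply: derive_bounded_lipschitz (fun t => @has_deriv_omega i t) _.
apply: bounded_mulmx; apply: bounded_addmx => [p q|]; first exact: bounded_pos_cst.
by apply: bounded_addmx; exact: bounded_mulmx.
Qed.

Let flow_tame i j : tame (fun t => flow N (eta t) i j).
Proof.
apply: tame_mulmx => e k; rewrite ord1.
have -> : (fun t => map_mx sin (eta t) e 0) = (fun t => sin (eta t e 0)).
  by apply/funext => t; rewrite mxE.
exact: tame_sin.
Qed.

Let domega_tame i j : tame (fun t => domega t i j).
Proof.
apply: tame_mulmx; apply: tame_addmx => [p q|]; first exact: tame_cst.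
by apply: tame_addmx; exact: tame_mulmx.
Qed.

Let z_tame i j : tame (fun t => z t i j).
Proof.
apply: tame_mulmx; apply: tame_addmx => // p q; exact: tame_cst.
Qed.

Let dW t := - dot (omega t) (damping N *m omega t) + - (kappa / tau) * dot (z t) (z t).

Let W t := storage N (eta t) (omega t).

Let W_derive (t : R) : 0 < t -> is_derive t 1 W (dW t).
Proof.
move=> t0; apply: has_deriv_on_pos => //.
have Jt : `[0, +oo[%classic t by rewrite /= in_itv /= andbT ltW.
have [] := dissipation tau_gt0 (gain_negsemidef SH_unit kappa_gt0) traj Jt.
rewrite dot_gain// enormK mulmxA -/eta -/(x t) -/G -/(z t) mulrN mulrA => WV _.
by rewrite /dW mulNr [kappa / tau]mulrC.
Qed.

Let W_bounded : bounded_pos W.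
Proof.
apply: bounded_posD.
  apply: bounded_posD; last exact: bounded_pos_cst.
  apply: bounded_posD.
    apply: bounded_posM; first exact: bounded_pos_cst.
    by apply: bounded_dot => //; exact: bounded_mulmx.
  apply: closed_sum; [exact: bounded_pos_cst|exact: bounded_posD|move=> e].
  apply: bounded_posM; first exact: bounded_pos_cst.
  apply: bounded_posD; first exact: bounded_pos_cst.
  by exists 1 => t _; rewrite normrN ler_norml cos_le1 cos_geN1.
have -> : (fun t => - dot (target_flow N) (eta t - target N)) =
    (fun t => dot (- target_flow N) (eta t - target N)).
  by apply/funext => t; rewrite [RHS]dotC dotNr dotC.
apply: bounded_dot => [p q|]; first exact: bounded_pos_cst.
by apply: bounded_addmx => // p q; exact: bounded_pos_cst.
Qed.

Let dW_tame : tame dW.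
Proof.
apply: tameD.
  have -> : (fun t => - dot (omega t) (damping N *m omega t)) =
      (fun t => dot (omega t) (- damping N *m omega t)).
    by apply/funext => t; rewrite mulNmx dotNr.
  by apply: tame_dot => //; exact: tame_mulmx.
by apply: tameM; [exact: tame_cst|exact: tame_dot].
Qed.

(* First use of Barbalat's lemma, on the storage. *)
Let dW_cvg0 : - dW t @[t --> +oo] --> (0 : R).
Proof.
have [s t s0 st|l Wl] := nonincreasing_bounded_cvg _ W_bounded.
  have [c _ /eqP] := mvt_pos W_derive s0 st.
  rewrite subr_eq => /eqP ->; rewrite gerDr mulr_le0_ge0 ?subr_ge0//; last exact: ltW.
  rewrite /dW mulNr -opprD oppr_le0 addr_ge0//.
    by rewrite dot_posdiag_ge0//; exact: damping_posdiag.
  by rewrite mulr_ge0 ?dot_ge0// divr_ge0// ltW.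
rewrite -oppr0; apply: cvgN.
exact: barbalat W_derive dW_tame.2 Wl.
Qed.

Let omega_cvg0 i : omega t i 0 @[t --> +oo] --> (0 : R).
Proof.
have [_ /(_ i) d_gt0] := damping_posdiag N.
apply: cvg0_sqr_le d_gt0 _ dW_cvg0 => t _; rewrite /dW opprD mulNr !opprK.
rewrite ler_wpDr//; first by rewrite mulr_ge0 ?dot_ge0// divr_ge0// ltW.
by apply: sqr_le_dot_posdiag; exact: damping_posdiag.
Qed.

Let z_cvg0 i : z t i 0 @[t --> +oo] --> (0 : R).
Proof.
apply: cvg0_sqr_le (divr_gt0 kappa_gt0 tau_gt0) _ dW_cvg0 => t _.
rewrite /dW opprD mulNr !opprK ler_wpDl//.
  by rewrite dot_posdiag_ge0//; exact: damping_posdiag.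
by rewrite ler_wpM2l ?sqr_le_dot// divr_ge0// ltW.
Qed.

(* Second use, on [omega], whose limit is 0 by the first. *)
Let domega_cvg0 i : domega t i 0 @[t --> +oo] --> (0 : R).
Proof.
apply: barbalat (@omega_cvg0 i); first by move=> t; exact: has_deriv_omega.
exact: (domega_tame i 0).2.
Qed.

(** The swing equation turns the decay of [omega] and [omega'] into that of
    [B (f - f_* )]; together with [z] it determines [f - f_*]. *)
Lemma flow_cvg : flow N (eta t) @[t --> +oo] --> target_flow N.
Proof.
have Bx t : incidence N *m x t =
    (- inertia N) *m domega t + (- damping N) *m omega t.
  rewrite mulNmx mulKVmx; last exact: posdiag_unitmx (inertia_posdiag N).
  rewrite mulmxBr -/(injection N) !mulNmx; apply/matrixP => i j.
  by rewrite !mxE; ring.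
have [L LE] := sensor_left_inverse ker_incidence SH_unit.
have xE t : flow N (eta t) = L *m col_mx (incidence N *m x t) (z t) + target_flow N.
  by rewrite /z -mul_col_mx mulmxA LE mul1mx subrK.
under eq_fun do rewrite xE.
suff : (L *m col_mx (incidence N *m x t) (z t) + target_flow N) @[t --> +oo] -->
    L *m 0 + target_flow N by rewrite mulmx0 add0r.
apply: cvgD; last exact: cvg_cst.
apply: cvg_mulmx; apply/mx_cvgP => i j; rewrite ord1 mxE.
have [k ->|k ->] := split_ordP i.
  under eq_fun do rewrite col_mxEu Bx.
  suff : (- inertia N *m domega t + - damping N *m omega t) @[t --> +oo] -->
      - inertia N *m (0 : 'cV[R]_n) + - damping N *m (0 : 'cV[R]_n).
    by rewrite !mulmx0 addr0 => /mx_cvgP/(_ k 0); rewrite mxE.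
  by apply: cvgD; apply: cvg_mulmx; apply/mx_cvgP => p q; rewrite ord1 mxE.
by under eq_fun do rewrite col_mxEd; exact: z_cvg0.
Qed.

End Convergence.

Theorem corollary12p18 (R : realType) (n m ns : nat) (N : network R n m)
    (tau : R) (S : 'M[R]_(ns, m)) (tau_gt0 : 0 < tau) :
  (forall K : 'M[R]_ns, K^T = K -> negsemidef K ->
   forall (J : set R) (theta omega : R -> 'cV[R]_n) (u : R -> 'cV[R]_m),
   time_interval J ->
   full_trajectory N tau (S^T *m K *m S) J theta omega u ->
   forall t, J t ->
   let eta := eff_angle N theta u in
   let y := S *m (flow N (eta t) - target_flow N) in
   let dV := - dot (omega t) (damping N *m omega t)
             + tau^-1 * dot y (K *m y) in
   has_deriv_on J (fun s => storage N (eta s) (omega s) : R^o) t dV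
   /\ dV <= 0)
  /\
  (forall (Sigma : 'M[R]_m) (H : 'M[R]_(m, ns)) (kappa : R),
   posdiag Sigma ->
   ns = cycle_rank N ->
   H^T *m invmx Sigma *m H = 1%:M ->
   (forall x : 'cV[R]_m, incidence N *m x = 0 <-> exists z, x = H *m z) ->
   let G : 'M[R]_ns := S *m H in
   G \in unitmx ->
   0 < kappa ->
   let K : 'M[R]_ns := - (kappa *: invmx (G *m G^T)) in
   (forall (J : set R) (theta omega : R -> 'cV[R]_n) (u : R -> 'cV[R]_m),
    time_interval J ->
    full_trajectory N tau (S^T *m K *m S) J theta omega u ->
    forall t, J t ->
    let eta := eff_angle N theta u in
    let y := S *m (flow N (eta t) - target_flow N) in
    let dV := - dot (omega t) (damping N *m omega t)
              - kappa / tau * enorm (invmx G *m y) ^+ 2 in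
    has_deriv_on J (fun s => storage N (eta s) (omega s) : R^o) t dV
    /\ dV <= 0)
   /\
   (forall (theta omega : R -> 'cV[R]_n) (u : R -> 'cV[R]_m)
      (Q : set ('cV[R]_m * 'cV[R]_n)),
    full_trajectory N tau (S^T *m K *m S) `[0, +oo[ theta omega u ->
    let eta := eff_angle N theta u in
    compact Q ->
    forward_invariant N tau (S^T *m K *m S) Q ->
    Q `<=` cohesive R m `*` setT ->
    (forall t, 0 <= t -> Q (eta t, omega t)) ->
    flow N (eta t) @[t --> +oo] --> target_flow N)).
Proof.
split=> [K _ K_neg J theta omega u _ traj t Jt|].
  exact: (dissipation tau_gt0 K_neg traj Jt).
move=> Sigma H kappa _ _ _ kerH G G_unit kappa_gt0 K; split.
  move=> J theta omega u _ traj t Jt eta y dV.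
  have := dissipation tau_gt0 (gain_negsemidef G_unit kappa_gt0) traj Jt.
  rewrite -/eta -/y /K dot_gain//.
  suff -> : tau^-1 * - (kappa * enorm (invmx G *m y) ^+ 2) =
            - (kappa / tau * enorm (invmx G *m y) ^+ 2) by [].
  by ring.
move=> theta omega u Q traj eta Q_compact _ _ Q_traj.
have /compact_bounded/pinfty_ex_gt0[C _ QC] := Q_compact.
have Q_norm t : 0 < t -> `|eta t| <= C /\ `|omega t| <= C.
  by move=> t0; have := QC _ (Q_traj t (ltW t0)); rewrite /= [X in X <= _]prod_normE ge_max => /andP.
apply: flow_cvg traj _ _ => // [x /kerH //|i j|i j]; exists C => t /Q_norm[etaC omegaC].
  exact: le_trans (le_mx_norm _ _ _) etaC.
exact: le_trans (le_mx_norm _ _ _) omegaC.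
Qed.
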